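(* Suppose $m\le d/2$ and the predictions $\hat\theta_1,\dots,\hat\theta_m$ are mutually orthogonal. There exist positive constants $c_1,c_2$ depending only on $\alpha$ and $\beta$ such that the following holds. Let $\epsilon:\mathbb{R}_+^m\to[0,\infty)$ be any separation curve satisfying the invariance property: whenever $\epsilon(r)=e$ for some $r\in\mathbb{R}_+^m$, then $\epsilon(r')=e$ for all $r'\in\mathbb{R}_+^m$ such that $\gamma_*(e,r)=\gamma_*(e,r')$. If the hypotheses $$H_0:\theta=0\quad\text{versus}\quad H_1:\ \exists\, r\in\mathbb{R}_+^m\text{ such that } \|\theta\|_2\ge\epsilon(r)\text{ and }\|\theta-\hat\theta_i\|_2\le r_i\text{ for all } i\in[m]$$ can be tested with nontrivial power, then for every $r\in\mathbb{R}_+^m$ with $S_{\epsilon(r)}\cap B_r\ne\emptyset$, $$\epsilon(r)\ \ge\ c_1\cdot\inf\Big\{e\ge0:\ n\ge c_2\cdot\Big(\frac{\sqrt m}{\gamma_*^2(e,r)}\wedge\frac{\sqrt d}{e^2}\Big)\ \text{ and }\ S_e\cap B_r\neq\emptyset\Big\}.$$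
   Context: $d,n,m\ge1$ are integers and $\hat\theta_1,\dots,\hat\theta_m\in\mathbb{R}^d$ are fixed nonzero vectors (predictions). One observes $X\sim P_\theta=\mathcal N(\theta,I_d/n)$ with unknown $\theta\in\mathbb{R}^d$. Fix $\alpha\in(0,1)$, $\beta\in(0,1-\alpha)$. A test is a measurable $\psi:\mathbb{R}^d\to\{0,1\}$; it is valid if $P_0(\psi(X)=1)\le\alpha$. A valid test is powerful if $\sup P_\theta(\psi(X)=0)<\beta$, the supremum being over all $\theta$ in the alternative $H_1$. ''Can be tested with nontrivial power'' means that a valid and powerful test exists. $S_e=\{\theta:\|\theta\|_2=e\}$; $B_r=\bigcap_{i=1}^m\{\theta:\|\theta-\hat\theta_i\|_2\le r_i\}$; $\hat U\in\mathbb{R}^{d\times m}$ has columns $\hat u_i=\hat\theta_i/\|\hat\theta_i\|_2$; $\Pi_{\hat U}$ is the orthogonal projection onto the column span of $\hat U$; $\gamma_*(e,r)\geq 0$ is given by $\gamma_*^2(e,r)=\inf_{\theta\in S_e\cap B_r}\|\Pi_{\hat U}\theta\|_2^2$. $a\wedge b=\min(a,b)$, $1/0=+\infty$, $\inf\emptyset=+\infty$. *)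

(* Defs.v *)
(* MathComp / MathComp-Analysis. *)
From HB Require Import structures.
From mathcomp Require Import all_boot all_order all_algebra.
From mathcomp Require Import all_classical all_reals all_analysis.
Set Implicit Arguments.
Unset Strict Implicit.
Unset Printing Implicit Defensive.
Import Order.TTheory GRing.Theory Num.Theory.
Local Open Scope classical_set_scope.
Local Open Scope ring_scope.

(* Parameters and predictions are row vectors; the library norm on matrices is
   the sup norm, hence the explicit Euclidean one. *)
Definition dotp (R : realType) (d : nat) (u v : 'rV[R]_d) : R :=
  \sum_(j < d) u ord0 j * v ord0 j.

Definition l2norm (R : realType) (d : nat) (u : 'rV[R]_d) : R :=
  Num.sqrt (\sum_(j < d) u ord0 j ^+ 2).

(* [R_+ = [0, +oo)]. *)
Definition nonneg_vec (R : realType) (m : nat) : set 'rV[R]_m :=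
  [set r | forall i, 0 <= r ord0 i].

Definition l2sphere (R : realType) (d : nat) (e : R) : set 'rV[R]_d :=
  [set theta | l2norm theta = e].

Definition ball_inter (R : realType) (d m : nat) (that : 'I_m -> 'rV[R]_d)
    (r : 'rV[R]_m) : set 'rV[R]_d :=
  [set theta | forall i, l2norm (theta - that i) <= r ord0 i].

Definition Uhat (R : realType) (d m : nat) (that : 'I_m -> 'rV[R]_d)
    : 'M[R]_(d, m) :=
  \matrix_(j < d, i < m) (that i ord0 j / l2norm (that i)).

(* Projection onto the column span of [U] (the row space of [U^T]) along
   [kermx U], the space of row vectors orthogonal to every column of [U];
   [colspan_proj_sub] and [colspan_proj_orth] check that it is the orthogonal
   projection for every [U]. *)
Definition colspan_proj (R : realType) (d m : nat) (U : 'M[R]_(d, m))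
    (theta : 'rV[R]_d) : 'rV[R]_d :=
  theta *m proj_mx <<U^T>>%MS (kermx U).

Lemma colspan_proj_sub (R : realType) (d m : nat) (U : 'M[R]_(d, m))
    (theta : 'rV[R]_d) : (colspan_proj U theta <= U^T)%MS.
Proof. by rewrite -(genmxE U^T) proj_mx_sub. Qed.

Lemma colspan_proj_orth (R : realType) (d m : nat) (U : 'M[R]_(d, m))
    (theta : 'rV[R]_d) : (theta - colspan_proj U theta) *m U = 0.
Proof.
have dxUK : (<<U^T>> :&: kermx U = 0)%MS.
  apply/eqP; rewrite -submx0; apply/rV_subP => v.
  rewrite sub_capmx genmxE => /andP[/submxP[w vE] /sub_kermxP vU].
  suff v0 : v = 0 by rewrite v0 sub0mx.
  have vv : (v *m v^T) ord0 ord0 = 0.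
    by rewrite {2}vE trmx_mul trmxK mulmxA vU mul0mx mxE.
  move: vv; rewrite mxE => /eqP; rewrite psumr_eq0; last first.
    by move=> j _; rewrite mxE -expr2 sqr_ge0.
  move=> /allP vj; apply/rowP => j; rewrite mxE.
  by have := vj j (mem_index_enum j); rewrite mxE -expr2 sqrf_eq0 => /eqP.
apply/sub_kermxP; apply: proj_mx_compl_sub.
apply: submx_full; rewrite /row_full (mxrank_disjoint_sum dxUK) mxrank_ker.
by rewrite genmxE mxrank_tr subnKC ?rank_leq_row.
Qed.

Definition gamma_star (R : realType) (d m : nat) (that : 'I_m -> 'rV[R]_d)
    (e : R) (r : 'rV[R]_m) : \bar R :=
  sqrte (ereal_inf [set (l2norm (colspan_proj (Uhat that) theta) ^+ 2)%:E
                   | theta in l2sphere e `&` ball_inter that r]).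

Section product_law.
Context (d : measure_display) (T : measurableType d) (R : realType) (n : nat).

Definition tcons (p : T * n.-tuple T) : n.+1.-tuple T :=
  [the n.+1.-tuple T of p.1 :: p.2].

Lemma measurable_tcons : measurable_fun [set: T * n.-tuple T] tcons.
Proof. exact: measurable_cons. Qed.

HB.instance Definition _ :=
  isMeasurableFun.Build _ _ _ _ tcons measurable_tcons.

Definition cons_law (P : probability T R) (Q : probability (n.-tuple T) R)
    : probability (n.+1.-tuple T) R :=
  distribution (P \x Q)%E tcons.

End product_law.

(* The law of a tuple of independent coordinates with [i]-th marginal [P i]. *)
Fixpoint product_law (d : measure_display) (T : measurableType d)
    (R : realType) (n : nat) : ('I_n -> probability T R) ->
    probability (n.-tuple T) R :=
  match n with
  | 0 => fun _ => dirac [tuple]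
  | n'.+1 => fun P =>
      cons_law (P ord0) (product_law (fun i => P (lift ord0 i)))
  end.

Lemma product_lawE (d : measure_display) (T : measurableType d)
    (R : realType) (n : nat) (P : 'I_n -> probability T R)
    (A : 'I_n -> set T) : (forall i, measurable (A i)) ->
  product_law P [set x | forall i, A i (tnth x i)] = (\prod_(i < n) P i (A i))%E.
Proof.
elim: n P A => [|n IHn] P A mA.
  by rewrite big_ord0 /= diracE mem_set// => -[].
rewrite big_ord_recl -(IHn (fun i => P (lift ord0 i)) (fun i => A (lift ord0 i)));
  last by move=> i; exact: mA.
have mB : measurable [set x : n.-tuple T | forall i, A (lift ord0 i) (tnth x i)].
  rewrite (_ : [set x | _] =
    \bigcap_(i in [set: 'I_n]) ((fun x => tnth x i) @^-1` A (lift ord0 i))).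
    apply: fin_bigcap_measurable => // i _; rewrite -[X in measurable X]setTI.
    exact: measurable_tnth.
  by apply/seteqP; split => x /= h i; [move=> _|]; exact: h.
rewrite /= /distribution /pushforward /= -product_measure1E//; congr (product_measure1 _ _ _).
apply/seteqP; split => -[a x] /=.
  move=> h; split; first exact: (h ord0).
  by move=> i /=; have := h (lift ord0 i); rewrite tnthS.
move=> [h0 h] i; case: (unliftP ord0 i) => [j ->|->//].
by rewrite tnthS; exact: h.
Qed.

(* [X] takes values in [d.-tuple R], which carries the product Borel
   sigma-algebra. The second argument of [normal_prob] is the standard
   deviation, here [1 / sqrt n]. *)
Definition gauss (R : realType) (d n : nat) (theta : 'rV[R]_d)
    : probability (d.-tuple (measurableTypeR R)) R :=
  product_law (fun j : 'I_d =>
    normal_prob (theta ord0 j) (Num.sqrt n%:R)^-1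
      : probability (measurableTypeR R) R).

Definition test (R : realType) (d : nat) :=
  {mfun d.-tuple (measurableTypeR R) >-> bool}.

Definition valid_test (R : realType) (d n : nat) (alpha : R)
    (psi : test R d) : Prop :=
  (gauss n (0 : 'rV[R]_d) [set x | psi x = true] <= alpha%:E)%E.

(* If [H1] is empty the supremum is [-oo], so the condition holds, as it does
   with the convention [sup set0 = 0] when [0 < beta]. *)
Definition powerful_test (R : realType) (d n : nat) (beta : R)
    (H1 : set 'rV[R]_d) (psi : test R d) : Prop :=
  (ereal_sup [set gauss n theta [set x | psi x = false] | theta in H1]
    < beta%:E)%E.

(* Testing [theta = 0] against [H1]. *)
Definition nontrivial_power (R : realType) (d n : nat) (alpha beta : R)
    (H1 : set 'rV[R]_d) : Prop :=
  exists psi : test R d, valid_test n alpha psi /\ powerful_test n beta H1 psi.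

Definition curve_alternative (R : realType) (d m : nat)
    (that : 'I_m -> 'rV[R]_d) (eps : 'rV[R]_m -> R) : set 'rV[R]_d :=
  [set theta | exists r, [/\ nonneg_vec r, eps r <= l2norm theta
                           & forall i, l2norm (theta - that i) <= r ord0 i]].

Definition gamma_invariant (R : realType) (d m : nat)
    (that : 'I_m -> 'rV[R]_d) (eps : 'rV[R]_m -> R) : Prop :=
  forall (e : R) (r : 'rV[R]_m), nonneg_vec r -> eps r = e ->
  forall r' : 'rV[R]_m, nonneg_vec r' ->
    gamma_star that e r = gamma_star that e r' -> eps r' = e.

(* Extended-real division: [x / 0 = +oo] for [0 < x]. *)
Definition critical_radius (R : realType) (d n m : nat)
    (that : 'I_m -> 'rV[R]_d) (c2 : R) (r : 'rV[R]_m) : \bar R :=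
  ereal_inf [set e%:E | e in [set e : R |
    [/\ 0 <= e,
        (c2%:E * Order.min ((Num.sqrt m%:R)%:E / gamma_star that e r ^+ 2)
                           ((Num.sqrt d%:R)%:E / (e%:E ^+ 2))
          <= (n%:R)%:E)%E
      & (l2sphere e `&` ball_inter that r) !=set0]]].

(* Main.v *)
Require Import Defs.
From mathcomp Require Import all_boot all_order all_algebra.
From mathcomp Require Import all_classical all_reals all_analysis.
From mathcomp Require Import measurable_realfun ring lra zify.
Import Order.TTheory GRing.Theory Num.Theory.
Local Open Scope classical_set_scope.
Local Open Scope ring_scope.
Set Implicit Arguments.
Unset Strict Implicit.
Unset Printing Implicit Defensive.

(** The constants are [c1 = 1] and a [c2] computed from the gap
    [1 - alpha - beta]: the radius [e = eps r] itself belongs to the set whose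
    infimum is the critical radius. Membership can only fail when both
    [n * gamma^2 < c2 * sqrt m] and [n * e^2 < c2 * sqrt d], with
    [gamma = gamma_star e r], and then no test beats the following prior on the
    alternative.

    Invariance makes the alternative large. If [theta] has norm [e],
    nonnegative coordinates along the directions of the predictions, and a
    projection of norm [gamma], put [r'_i = |theta - that_i|]. On the sphere of
    radius [e] the ball around [that_i] is the cap cut out by a lower bound on
    the [i]-th coordinate, so [theta] minimises the projected norm over
    [S_e] and [B_r'], whence [gamma_star e r' = gamma] and [eps r' = e]
    ([gamma_star_touching]). Every such [theta] is therefore in the
    alternative.

    The prior must live in the positive orthant of the span of the predictions,
    so random signs, which are the usual choice, are unavailable. Instead the
    coordinates contain [p * p] cells with [p] about [sqrt m], arranged in [p]
    blocks of size [p]; one cell is drawn uniformly in each block and receives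
    the value [gamma / sqrt p]. Two independent draws agree in about one block,
    which gives exponential moments of their inner product of constant order
    as long as [n * gamma^2] is at most of order [sqrt m] ([block_prior]). The
    remaining norm [sqrt (e^2 - gamma^2)] is spread by the same construction
    over an orthonormal complement of the predictions, of dimension
    [d - m >= d / 2] ([orthonormal_complement]). The two parts being orthogonal
    and independent, the exponential moments multiply.

    Testing against a mixture is controlled by the second moment of its
    likelihood ratio ([second_moment_bound]): for Gaussian shifts this is the
    average of [exp (n <theta, theta'>)] over two independent draws of the
    prior, so that a value close to [1] contradicts the existence of a valid
    and powerful test ([not_powerful]). *)

(** * Gaussian shifts *)

(** A Radon-Nikodym derivative is determined almost everywhere by its
    integrals, so the abstract derivative of the normal law is its density. *)
Lemma integral_normal_probE (R : realType) (mean s : R) (f : measurableTypeR R -> \bar R) :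
  measurable_fun setT f -> (forall x, 0 <= f x)%E ->
  (\int[normal_prob mean s]_x f x =
   \int[lebesgue_measure]_x (f x * (normal_pdf mean s x)%:E))%E.
Proof.
move=> mf f0.
rewrite -(Radon_Nikodym_SigmaFinite.change_of_variables
  (normal_prob_dominates mean s))//.
have dom := normal_prob_dominates mean s.
have mpdf : measurable_fun setT (fun x => (normal_pdf mean s x)%:E).
  by apply/measurable_EFinP; exact: measurable_normal_pdf.
have iRN := Radon_Nikodym_SigmaFinite.f_integrable dom.
apply: ae_eq_integral => //.
- apply: emeasurable_funM => //; exact: (measurable_int _ iRN).
- exact: emeasurable_funM.
apply: ae_eqe_mul2l.
apply: integral_ae_eq => // A _ mA.
by rewrite -(Radon_Nikodym_SigmaFinite.f_integral dom).
Qed.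

(** The normalising constants of the two densities cancel, and the quadratic
    terms in [x] of the exponents as well. *)
Lemma normal_prob_shift (R : realType) (mean s : R) (f : measurableTypeR R -> \bar R) :
  s != 0 -> measurable_fun setT f -> (forall x, 0 <= f x)%E ->
  (\int[normal_prob mean s]_x f x = \int[normal_prob 0 s]_x
    (f x * (expR ((mean * x - mean ^+ 2 / 2) / s ^+ 2))%:E))%E.
Proof.
move=> s0 mf f0.
have mL : measurable_fun [set: R]
    (fun x : R => (expR ((mean * x - mean ^+ 2 / 2) / s ^+ 2))%:E).
  apply/measurable_EFinP; apply: measurableT_comp => //.
  apply: measurable_funM => //; apply: measurable_funB => //.
rewrite (integral_normal_probE _ _ mf f0).
have mfL := emeasurable_funM mf mL.
rewrite (integral_normal_probE _ _ mfL); last first.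
  by move=> x; apply: mule_ge0; rewrite ?lee_fin ?expR_ge0.
apply: eq_integral => x _; rewrite -muleA -EFinM; congr (_ * _%:E)%E.
rewrite !normal_pdfE// /normal_fun mulrCA -expRD; congr (_ * expR _).
by field.
Qed.

(** Densities multiply under independence. The hypothesis on the marginals
    quantifies over all nonnegative integrands, not only over indicators: the
    induction applies it to the partial integrals given by Tonelli's
    theorem. *)
Lemma product_law_density (disp : measure_display) (T : measurableType disp)
    (R : realType) (n : nat) (P Q : 'I_n -> probability T R)
    (g : 'I_n -> T -> R) :
  (forall i, measurable_fun setT (g i)) -> (forall i x, 0 <= g i x) ->
  (forall i (f : T -> \bar R), measurable_fun setT f ->
    (forall x, 0 <= f x)%E ->
    (\int[Q i]_x f x = \int[P i]_x (f x * (g i x)%:E))%E) ->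
  forall h : n.-tuple T -> \bar R, measurable_fun setT h ->
    (forall x, 0 <= h x)%E ->
  (\int[product_law Q]_x h x =
   \int[product_law P]_x (h x * (\prod_(i < n) g i (tnth x i))%:E))%E.
Proof.
elim: n P Q g => [|n IHn] P Q g mg g0 PQ h mh h0.
  by apply: eq_integral => x _; rewrite big_ord0 mule1.
have mprod k (u : 'I_k -> T -> R) : (forall i, measurable_fun setT (u i)) ->
    measurable_fun setT (fun x : k.-tuple T => (\prod_(i < k) u i (tnth x i))%:E).
  move=> mu; apply/measurable_EFinP; apply: measurable_prod => i _.
  by apply: measurableT_comp => //; exact: measurable_tnth.
have prod_ge0 k (u : 'I_k -> T -> R) x : (forall i x, 0 <= u i x) ->
    (0 <= (\prod_(i < k) u i (tnth x i))%:E)%E.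
  by move=> u0; rewrite lee_fin prodr_ge0.
have hc : measurable_fun setT (h \o @tcons _ T n).
  by apply: measurableT_comp => //; exact: measurable_tcons.
have mhg : measurable_fun setT
    (fun x : n.+1.-tuple T => (h x * (\prod_(i < n.+1) g i (tnth x i))%:E)%E).
  by apply: emeasurable_funM => //; exact: mprod.
have hg0 (x : n.+1.-tuple T) :
    (0 <= h x * (\prod_(i < n.+1) g i (tnth x i))%:E)%E.
  by rewrite mule_ge0// prod_ge0.
rewrite /= /cons_law !ge0_integral_distribution//.
rewrite !fubini_tonelli1//=; last exact: measurableT_comp mhg (@measurable_tcons _ T n).
rewrite PQ//; first last.
- by move=> x; apply: integral_ge0 => y _; exact: h0.
- by apply: measurable_fun_fubini_tonelli_F => // x; exact: h0.
apply: eq_integral => x _; rewrite /fubini_F.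
have hx : measurable_fun setT (fun y => (h \o @tcons _ T n) (x, y)).
  exact: (measurableT_comp hc (pair1_measurable x)).
rewrite (IHn _ _ _ (fun i => mg (lift ord0 i)) (fun i => g0 (lift ord0 i))
  (fun i => PQ (lift ord0 i)) _ hx)/=; last by move=> y; exact: h0.
rewrite muleC -ge0_integralZl//; first last.
- by rewrite lee_fin.
- move=> y _; apply: mule_ge0; first exact: h0.
  by rewrite lee_fin prodr_ge0.
- apply: emeasurable_funM => //.
  by apply: (mprod _ (fun i => g (lift ord0 i))) => i; exact: mg.
apply: eq_integral => y _ /=.
rewrite big_ord_recl EFinM muleCA; congr (_ * (_ * _))%E.
by congr EFin; apply: eq_bigr => i _; rewrite tnthS.
Qed.

(** The likelihood ratio of [gauss n theta] to [gauss n 0]. *)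
Definition lik (R : realType) (d n : nat) (theta : 'rV[R]_d)
    (x : d.-tuple (measurableTypeR R)) : R :=
  \prod_(j < d) expR (n%:R * (theta ord0 j * tnth x j - theta ord0 j ^+ 2 / 2)).

Section likelihood.
Context (R : realType) (d n : nat).
Implicit Types theta : 'rV[R]_d.

Lemma lik_ge0 theta x : 0 <= lik n theta x.
Proof. by apply: prodr_ge0 => j _; exact: expR_ge0. Qed.

Lemma lik0 x : lik n (0 : 'rV[R]_d) x = 1.
Proof. by apply: big1 => j _; rewrite mxE mul0r expr0n mul0r subrr mulr0 expR0. Qed.

(** Likelihood ratios are closed under products up to a constant, so second
    moments of mixtures need no further Gaussian integral. *)
Lemma lik_mul (a b : 'rV[R]_d) x :
  lik n a x * lik n b x = expR (n%:R * dotp a b) * lik n (a + b) x.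
Proof.
rewrite /dotp mulr_sumr expR_sum -!big_split /=; apply: eq_bigr => j _.
by rewrite -!expRD mxE; congr expR; field.
Qed.

Lemma measurable_lik theta :
  measurable_fun [set: d.-tuple (measurableTypeR R)] (lik n theta).
Proof.
apply: measurable_prod => j _.
apply: (measurableT_comp (@measurable_expR R)).
apply: measurable_funM => //; apply: measurable_funB => //.
apply: measurable_funM => //; exact: measurable_tnth.
Qed.

Lemma integral_gaussE theta (h : d.-tuple (measurableTypeR R) -> \bar R) :
  (0 < n)%N -> measurable_fun setT h -> (forall x, 0 <= h x)%E ->
  (\int[gauss n theta]_x h x =
   \int[gauss n 0%R]_x (h x * (lik n theta x)%:E))%E.
Proof.
move=> n0 mh h0.
have sn0 : 0 < Num.sqrt n%:R :> R by rewrite sqrtr_gt0 ltr0n.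
have s0 : (Num.sqrt n%:R)^-1 != 0 :> R by rewrite invr_eq0 gt_eqF.
pose s := (Num.sqrt n%:R : R)^-1.
pose P (t : R) : probability (measurableTypeR R) R := normal_prob t s.
pose g (j : 'I_d) (x : measurableTypeR R) : R :=
  expR (n%:R * (theta ord0 j * x - theta ord0 j ^+ 2 / 2)).
have mg j : measurable_fun setT (g j).
  apply: (measurableT_comp (@measurable_expR R)).
  by apply: measurable_funM => //; apply: measurable_funB.
have g0 j x : 0 <= g j x by exact: expR_ge0.
have Pg j (f : measurableTypeR R -> \bar R) : measurable_fun setT f ->
    (forall x, 0 <= f x)%E ->
    (\int[P (theta ord0 j)]_x f x =
     \int[P ((0%R : 'rV[R]_d) ord0 j)]_x (f x * (g j x)%:E))%E.
  move=> mf f0; rewrite mxE /P (normal_prob_shift _ s0 mf f0).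
  apply: eq_integral => x _; congr (_ * (expR _)%:E)%E.
  by rewrite exprVn sqr_sqrtr ?ler0n// invrK mulrC.
exact: (product_law_density mg g0 Pg mh h0).
Qed.

#[local] Opaque gauss.

Lemma integral_lik_indic theta A : (0 < n)%N -> measurable A ->
  (\int[gauss n 0%R]_x (lik n theta x * \1_A x)%:E = gauss n theta A)%E.
Proof.
move=> n0 mA; rewrite -[in RHS](setIT A) -integral_indic; [|exact: measurableT|exact: mA].
have mI : measurable_fun setT (EFin \o (\1_A : _ -> R)).
  by apply/measurable_EFinP; exact: measurable_indic.
rewrite (integral_gaussE _ n0 mI); last by move=> x; rewrite lee_fin.
by apply: eq_integral => x _; rewrite mulrC EFinM.
Qed.

(** All integrals of the second moment argument are of this form, with
    nonnegative coefficients, which keeps every integrability condition out of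
    the way. *)
Lemma integral_lik_comb (J : finType) (c : J -> R) (th : J -> 'rV[R]_d)
    (B : J -> set (d.-tuple (measurableTypeR R))) :
  (0 < n)%N -> (forall j, 0 <= c j) -> (forall j, measurable (B j)) ->
  (\int[gauss n 0%R]_x (\sum_j c j * (lik n (th j) x * \1_(B j) x))%:E =
   \sum_j (c j)%:E * gauss n (th j) (B j))%E.
Proof.
move=> n0 c0 mB.
under eq_integral do rewrite -sumEFin.
have m j : measurable_fun setT (fun x => (lik n (th j) x * \1_(B j) x)%:E).
  apply/measurable_EFinP; apply: measurable_funM; first exact: measurable_lik.
  exact: measurable_indic.
rewrite ge0_integral_sum//; last 2 first.
- move=> j; under eq_fun do rewrite EFinM.
  exact: emeasurable_funM.
- by move=> j x _; rewrite lee_fin !mulr_ge0// lik_ge0.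
apply: eq_bigr => j _; under eq_integral do rewrite EFinM.
rewrite ge0_integralZl_EFin//; last by move=> x _; rewrite lee_fin mulr_ge0// lik_ge0.
by rewrite integral_lik_indic.
Qed.

End likelihood.

(** * The second moment method *)

(** With [L] the likelihood ratio of the mixture of the [th i], Chebyshev's
    argument bounds [gauss n 0 A - E_0 (L 1_A) = E_0 ((1 - L) 1_A)] through
    [2 delta (1 - L) <= delta^2 + (1 - L)^2], whose right-hand side has mean at
    most [2 delta^2]. *)
Lemma second_moment_bound (R : realType) (d n : nat) (I : finType)
    (th : I -> 'rV[R]_d) (A : set (d.-tuple (measurableTypeR R))) (b delta : R) :
  (0 < n)%N -> (0 < #|I|)%N -> 0 < delta -> measurable A ->
  \sum_i \sum_j expR (n%:R * dotp (th i) (th j)) <=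
    (1 + delta ^+ 2) * #|I|%:R ^+ 2 ->
  (forall i, gauss n (th i) A <= b%:E)%E ->
  (gauss n 0%R A <= (b + delta)%:E)%E.
Proof.
move=> n0 I0 delta0 mA hsum hb.
set N : R := #|I|%:R.
have N0 : 0 < N by rewrite ltr0n.
pose p (t : 'rV[R]_d) := fine (gauss n t A).
have pE t : gauss n t A = (p t)%:E by rewrite fineK// fin_num_measure.
have gT t : gauss n t setT = 1%E :> \bar R by exact: probability_setT.
pose L x : R := N^-1 * \sum_i lik n (th i) x.
(* The pointwise inequality
     2 delta 1_A + 2 L <= (1 + delta^2) + L^2 + 2 delta L 1_A
   with both sides written as nonnegative combinations of likelihood ratios:
   the coefficients, shifts and events of its left-hand side are [c1], [t1],
   [B1], those of its right-hand side [c2], [t2], [B2]. *)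
pose c1 (j : unit + I) : R := if j is inr _ then 2 / N else 2 * delta.
pose t1 (j : unit + I) := if j is inr i then th i else 0.
pose B1 (j : unit + I) : set (d.-tuple (measurableTypeR R)) :=
  if j is inr _ then setT else A.
pose c2 (j : unit + I * I + I) : R :=
  match j with
  | inl (inl _) => 1 + delta ^+ 2
  | inl (inr ij) => N^-1 ^+ 2 * expR (n%:R * dotp (th ij.1) (th ij.2))
  | inr _ => 2 * delta / N
  end.
pose t2 (j : unit + I * I + I) :=
  match j with
  | inl (inl _) => 0
  | inl (inr ij) => th ij.1 + th ij.2
  | inr i => th i
  end.
pose B2 (j : unit + I * I + I) : set (d.-tuple (measurableTypeR R)) :=
  if j is inr _ then A else setT.
have mB1 j : measurable (B1 j) by case: j => [[]|j]; [exact: mA|exact: measurableT].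
have mB2 j : measurable (B2 j).
  by case: j => j; [exact: measurableT|exact: mA].
have c10 j : 0 <= c1 j.
  by case: j => _ /=; rewrite ?mulr_ge0 ?invr_ge0 ?(ltW N0) ?(ltW delta0).
have c20 j : 0 <= c2 j.
  case: j => [[_|ij]|_] /=; first by rewrite addr_ge0 ?sqr_ge0.
    by rewrite mulr_ge0 ?sqr_ge0 ?expR_ge0.
  by rewrite !mulr_ge0 ?invr_ge0 ?(ltW N0) ?(ltW delta0).
have pointwise x :
    \sum_j c1 j * (lik n (t1 j) x * \1_(B1 j) x) <=
    \sum_j c2 j * (lik n (t2 j) x * \1_(B2 j) x).
  rewrite !big_sumType /= !big_const !card_unit /= !addr0 !lik0 !mul1r.
  rewrite !indicT.
  have -> : \sum_(i : I) 2 / N * (lik n (th i) x * cst 1 x) = 2 * L x.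
    by rewrite /L -!mulr_sumr mulrA; congr (_ * _); apply: eq_bigr => i _; rewrite mulr1.
  have -> : \sum_(i : I) 2 * delta / N * (lik n (th i) x * \1_A x) =
      2 * delta * L x * \1_A x.
    by rewrite /L -!mulr_sumr -mulr_suml !mulrA.
  have -> : \sum_(ij : I * I) N^-1 ^+ 2 * expR (n%:R * dotp (th ij.1) (th ij.2)) *
      (lik n (th ij.1 + th ij.2) x * cst 1 x) = L x ^+ 2.
    rewrite /L exprMn [in RHS](expr2 (bigop _ _ _)) big_distrlr /= pair_big /= mulr_sumr.
    by apply: eq_bigr => ij _; rewrite mulr1 -mulrA -lik_mul.
  rewrite indicE; set l := L x; case: (x \in A) => /=; rewrite ?mulr1 ?mulr0.
    by have := sqr_ge0 (1 - l - delta); nra.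
  by have := sqr_ge0 (1 - l); nra.
have mlik J (s : seq J) c t B : (forall j, measurable (B j)) ->
    measurable_fun [set: d.-tuple (measurableTypeR R)]
      (fun x => (\sum_(j <- s) c j * (lik n (t j) x * \1_(B j) x))%:E).
  move=> mB; apply/measurable_EFinP; apply: measurable_sum => j.
  apply: measurable_funM => //; apply: measurable_funM; first exact: measurable_lik.
  exact: measurable_indic.
have s0 J (s : seq J) c t B x : (forall j, 0 <= c j) ->
    0 <= \sum_(j <- s) c j * (lik n (t j) x * \1_(B j) x).
  by move=> c0; apply: sumr_ge0 => j _; rewrite !mulr_ge0// lik_ge0.
have key : (\sum_j (c1 j)%:E * gauss n (t1 j) (B1 j) <=
            \sum_j (c2 j)%:E * gauss n (t2 j) (B2 j))%E.
  rewrite -!integral_lik_comb//; apply: ge0_le_integral.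
  - exact: measurableT.
  - by move=> x _; rewrite lee_fin s0.
  - exact: mlik.
  - exact: mlik.
  - by move=> x _; rewrite lee_fin pointwise.
move: key; rewrite !big_sumType /= !big_const !card_unit /= !adde0 gT mule1.
under eq_bigr do rewrite gT mule1.
under [X in (_ <= _ + X + _)%E]eq_bigr do rewrite gT mule1.
under [X in (_ <= _ + X)%E]eq_bigr do rewrite pE -EFinM.
rewrite pE !sumEFin -!EFinM -!EFinD !lee_fin.
rewrite sumr_const -[_ *+ #|_|]mulr_natr -/N divfK ?gt_eqF// -!mulr_sumr.
rewrite -(pair_bigA _ (fun i j => expR (n%:R * dotp (th i) (th j)))) /=.
move=> key.
have h1 : N^-1 ^+ 2 * \sum_i \sum_j expR (n%:R * dotp (th i) (th j)) <= 1 + delta ^+ 2.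
  by rewrite exprVn mulrC ler_pdivrMr// exprn_gt0.
have h2 : 2 * delta / N * \sum_i p (th i) <= 2 * delta * b.
  rewrite -!mulrA !ler_pM2l// mulrC ler_pdivrMr//.
  have -> : b * N = \sum_(i : I) b by rewrite sumr_const mulr_natr.
  by apply: ler_sum => i _; rewrite -lee_fin -pE.
rewrite -(ler_pM2l (_ : 0 < 2 * delta)) ?mulr_gt0//.
lra.
Qed.

(** * Sparse priors in the positive orthant *)

Lemma floor_sqrt (k : nat) : exists p, (p * p <= k < p.+1 * p.+1)%N.
Proof.
elim: k => [|k [p /andP[h1 h2]]]; first by exists 0%N.
have [h|h] := ltnP k.+1 (p.+1 * p.+1); first by exists p; lia.
by exists p.+1; lia.
Qed.

Section block_vectors.
Context (R : realType) (k p : nat) (h : 'I_p * 'I_p -> 'I_k) (a : R).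
Hypothesis h_inj : injective h.

(** The cells of a [p * p] grid are identified by [h] with some of the [k]
    coordinates, and [f] selects one cell in each row of the grid. *)
Definition block_vec (f : {ffun 'I_p -> 'I_p}) : 'rV[R]_k :=
  \row_j (a * \sum_i (j == h (i, f i))%:R).

Lemma dotp_block_vec (f g : {ffun 'I_p -> 'I_p}) :
  dotp (block_vec f) (block_vec g) = a ^+ 2 * \sum_i (f i == g i)%:R.
Proof.
have valE i : \sum_i' (h (i, f i) == h (i', g i'))%:R = (f i == g i)%:R :> R.
  rewrite (bigD1 i)//= big1 ?addr0; last first.
    by move=> i' ii'; rewrite (inj_eq h_inj) xpair_eqE eq_sym (negbTE ii').
  by rewrite (inj_eq h_inj) xpair_eqE eqxx.
rewrite /dotp; under eq_bigr do rewrite !mxE mulrACA -expr2.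
rewrite -mulr_sumr; congr (_ * _).
under eq_bigr do rewrite mulr_suml.
rewrite exchange_big /=; apply: eq_bigr => i _.
rewrite (bigD1 (h (i, f i)))//= [X in _ + X]big1 ?addr0; last first.
  by move=> j /negbTE jn; rewrite jn mul0r.
by rewrite eqxx mul1r valE.
Qed.

(** For fixed [f] the rows are independent and each agrees with [f] with
    probability [1/p], so the average over [g] is [(1 + (e^l - 1) / p)^p],
    which stays below [exp (e^l - 1)] whatever [p]. *)
Lemma sum_expR_block_vec (l : R) : (0 < p)%N ->
  \sum_(f : {ffun 'I_p -> 'I_p}) \sum_(g : {ffun 'I_p -> 'I_p})
    expR (l * \sum_i (f i == g i)%:R) <=
    expR (expR l - 1) * #|{ffun 'I_p -> 'I_p}|%:R ^+ 2
    :> R.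
Proof.
move=> p0.
have p0R : 0 < p%:R :> R by rewrite ltr0n.
have inner (f : {ffun 'I_p -> 'I_p}) :
    \sum_(g : {ffun 'I_p -> 'I_p}) expR (l * \sum_i (f i == g i)%:R) =
    (p%:R - 1 + expR l) ^+ p.
  under eq_bigr do rewrite mulr_sumr expR_sum.
  rewrite -(bigA_distr_bigA (fun i j => expR (l * (f i == j)%:R))) /=.
  rewrite -[in RHS](card_ord p) -prodr_const; apply: eq_bigr => i _.
  rewrite (bigD1 (f i))//= eqxx mulr1 addrC; congr (_ + _).
  rewrite (eq_bigr (fun=> 1)); last first.
    by move=> j; rewrite eq_sym => /negbTE jn; rewrite jn mulr0 expR0.
  by rewrite sumr_const cardC1 card_ord -subn1 natrB.
under eq_bigr do rewrite inner.
rewrite sumr_const -[_ *+ #|_|]mulr_natr expr2 mulrA ler_wpM2r//.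
rewrite card_ffun card_ord natrX.
have -> : expR (expR l - 1) = expR ((expR l - 1) / p%:R) ^+ p.
  by rewrite -expRM_natl mulrC divfK// gt_eqF.
rewrite -exprMn; apply: lerXn2r; rewrite ?nnegrE.
- by rewrite addr_ge0 ?expR_ge0// subr_ge0 ler1n.
- by rewrite mulr_ge0 ?expR_ge0// ltW.
have -> : p%:R - 1 + expR l = (1 + (expR l - 1) / p%:R) * p%:R.
  by rewrite mulrDl divfK ?gt_eqF//; ring.
by rewrite ler_wpM2r ?ler0n// expR_ge1Dx.
Qed.

End block_vectors.

(** The exponent [L * s / p] of one agreement is of constant order since [p] is
    the integer part of [sqrt k]; the factor [2] pays for that rounding. *)
Lemma block_prior (R : realType) (k : nat) (s kappa L : R) :
  (0 < k)%N -> 0 <= s -> 0 <= L -> 0 <= kappa -> L * s <= kappa * Num.sqrt k%:R ->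
  exists (I : finType) (v : I -> 'rV[R]_k),
    [/\ (0 < #|I|)%N, forall i j, 0 <= v i ord0 j,
        forall i, dotp (v i) (v i) = s &
        \sum_i \sum_j expR (L * dotp (v i) (v j)) <=
          expR (expR (2 * kappa) - 1) * #|I|%:R ^+ 2].
Proof.
move=> k0 s0 L0 kappa0 hLs.
have [p /andP[pk kp]] := floor_sqrt k.
have p0 : (0 < p)%N by case: p pk kp => // _; lia.
have p0R : 0 < p%:R :> R by rewrite ltr0n.
have cardpp : #|{: 'I_p * 'I_p}| = (p * p)%N by rewrite card_prod !card_ord.
have pk' : (#|{: 'I_p * 'I_p}| <= k)%N by rewrite cardpp.
pose h (x : 'I_p * 'I_p) := widen_ord pk' (enum_rank x).
have h_inj : injective h.
  by move=> x y /(congr1 val) /= /val_inj /enum_rank_inj.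
have a2 : Num.sqrt (s / p%:R) ^+ 2 = s / p%:R.
  by rewrite sqr_sqrtr// divr_ge0// ltW.
exists {ffun 'I_p -> 'I_p}, (block_vec h (Num.sqrt (s / p%:R))); split.
- by rewrite card_ffun card_ord expn_gt0 p0.
- by move=> f j; rewrite mxE mulr_ge0 ?sqrtr_ge0// sumr_ge0.
- move=> f; rewrite dotp_block_vec// a2.
  under eq_bigr do rewrite eqxx.
  by rewrite sumr_const card_ord divfK// gt_eqF.
under eq_bigr do under eq_bigr do rewrite dotp_block_vec// a2 mulrA.
apply: (le_trans (sum_expR_block_vec _ p0)).
rewrite ler_wpM2r ?exprn_ge0// ler_expR lerD2r ler_expR.
rewrite mulrA ler_pdivrMr//; apply: (le_trans hLs).
rewrite -mulrA mulrCA ler_wpM2l//.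
have sp : Num.sqrt k%:R <= p.+1%:R :> R.
  rewrite -[leRHS]ger0_norm// -sqrtr_sqr ler_wsqrtr// -natrX ler_nat; lia.
by apply: (le_trans sp); rewrite -natrM ler_nat; lia.
Qed.

(** * Orthogonal predictions *)

Section euclid.
Context (R : realType).

Lemma dotpE (d : nat) (u v : 'rV[R]_d) : dotp u v = (u *m v^T) ord0 ord0.
Proof. by rewrite mxE; apply: eq_bigr => j _; rewrite mxE. Qed.

Lemma dotpp_ge0 (d : nat) (u : 'rV[R]_d) : 0 <= dotp u u.
Proof. by apply: sumr_ge0 => j _; rewrite -expr2 sqr_ge0. Qed.

Lemma dotpp_eq0 (d : nat) (u : 'rV[R]_d) : (dotp u u == 0) = (u == 0).
Proof.
apply/idP/eqP => [|->]; last first.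
  by apply/eqP/big1 => j _; rewrite mxE mul0r.
rewrite psumr_eq0; last by move=> j _; rewrite -expr2 sqr_ge0.
move=> /allP h; apply/rowP => j; rewrite mxE; apply/eqP.
by have := h j (mem_index_enum j); rewrite -expr2 sqrf_eq0.
Qed.

Lemma l2normE (d : nat) (u : 'rV[R]_d) : l2norm u = Num.sqrt (dotp u u).
Proof. by congr Num.sqrt; apply: eq_bigr => j _; rewrite expr2. Qed.

Lemma sqr_l2norm (d : nat) (u : 'rV[R]_d) : l2norm u ^+ 2 = dotp u u.
Proof. by rewrite l2normE sqr_sqrtr// dotpp_ge0. Qed.

Lemma dotp_distr (d : nat) (u v : 'rV[R]_d) :
  dotp (u - v) (u - v) = dotp u u - 2 * dotp u v + dotp v v.
Proof.
rewrite /dotp mulr_sumr -sumrB -big_split /=; apply: eq_bigr => j _.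
by rewrite !mxE; ring.
Qed.

(** Fewer than [d] rows never span, so the family can be extended one
    normalised kernel vector at a time. *)
Lemma orthonormal_complement (m k d : nat) (A : 'M[R]_(m, d)) :
  A *m A^T = 1%:M -> (m + k <= d)%N ->
  exists B : 'M[R]_(k, d), B *m B^T = 1%:M /\ A *m B^T = 0.
Proof.
move=> AA; elim: k => [|k IHk] mkd.
  by exists 0; split; [apply/matrixP => -[]|apply/matrixP => i []].
have [|B [BB AB]] := IHk; first by lia.
pose C := col_mx A B.
have : kermx C^T != 0.
  rewrite kermx_eq0 /row_free neq_ltn; apply/orP; left.
  by rewrite (leq_ltn_trans (rank_leq_col _))//; lia.
move=> /rowV0Pn[w /sub_kermxP wC w0].
have [wA wB] : w *m A^T = 0 /\ w *m B^T = 0.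
  move: wC; rewrite tr_col_mx mul_mx_row -[0]row_mx0.
  exact: eq_row_mx.
have ww : dotp w w != 0 by rewrite dotpp_eq0.
pose c := (Num.sqrt (dotp w w))^-1.
have c2 : c * c = (dotp w w)^-1.
  by rewrite -expr2 exprVn sqr_sqrtr// dotpp_ge0.
pose B' : 'M[R]_(1 + k, d) := col_mx (c *: w) B.
have BB' : B' *m B'^T = 1%:M.
  rewrite tr_col_mx mul_col_mx !mul_mx_row scalar_mx_block BB.
  congr block_mx.
  - rewrite linearZ /= -scalemxAl -scalemxAr scalerA c2.
    apply/matrixP => i j; rewrite !mxE !ord1 eqxx -[RHS](mulVf ww).
    by rewrite dotpE mxE.
  - by rewrite -scalemxAl wB scaler0.
  - by apply: trmx_inj; rewrite trmx_mul trmxK -scalemxAl wB scaler0 trmx0.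
have AB' : A *m B'^T = 0.
  rewrite tr_col_mx mul_mx_row AB linearZ /= -scalemxAr.
  have -> : A *m w^T = 0 by apply: trmx_inj; rewrite trmx_mul trmxK wA trmx0.
  by rewrite scaler0 row_mx0.
by exists B'.
Qed.

Lemma colspan_projE (d m : nat) (U : 'M[R]_(d, m)) (theta : 'rV[R]_d) :
  U^T *m U = 1%:M -> colspan_proj U theta = theta *m U *m U^T.
Proof.
move=> UU; have /submxP[w wE] := colspan_proj_sub U theta.
have := colspan_proj_orth U theta.
rewrite wE mulmxBl -(mulmxA w) UU mulmx1 => /eqP; rewrite subr_eq0 => /eqP ->.
by [].
Qed.

Lemma dotp_mulmx (d m : nat) (A : 'M[R]_(m, d)) (x y : 'rV[R]_m) :
  A *m A^T = 1%:M -> dotp (x *m A) (y *m A) = dotp x y.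
Proof. by move=> AA; rewrite !dotpE trmx_mul mulmxA -(mulmxA x) AA mulmx1. Qed.

Section predictions.
Context (d m : nat) (that : 'I_m -> 'rV[R]_d).
Hypothesis that0 : forall i, that i != 0.
Hypothesis that_orth : forall i j, i != j -> dotp (that i) (that j) = 0.
Local Notation U := (Uhat that).

Lemma l2norm_that_gt0 i : 0 < l2norm (that i).
Proof. by rewrite l2normE sqrtr_gt0 lt_def dotpp_eq0 that0 dotpp_ge0. Qed.

Lemma Uhat_orthonormal : U^T *m U = 1%:M.
Proof.
apply/matrixP => i j; rewrite !mxE.
have -> : \sum_k U^T i k * U k j =
    dotp (that i) (that j) / (l2norm (that i) * l2norm (that j)).
  rewrite /dotp mulr_suml; apply: eq_bigr => k _; rewrite !mxE.
  by rewrite invfM mulrACA.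
have [<-|ij] := eqVneq i j; last by rewrite that_orth// mul0r.
by rewrite -sqr_l2norm -expr2 divff// expf_neq0// gt_eqF// l2norm_that_gt0.
Qed.

Lemma dotp_that (theta : 'rV[R]_d) i :
  dotp theta (that i) = l2norm (that i) * (theta *m U) ord0 i.
Proof.
rewrite mxE mulr_sumr; apply: eq_bigr => j _; rewrite mxE.
by rewrite [RHS]mulrC -mulrA divfK// gt_eqF// l2norm_that_gt0.
Qed.

Lemma sqr_l2norm_proj (theta : 'rV[R]_d) :
  l2norm (colspan_proj U theta) ^+ 2 = dotp (theta *m U) (theta *m U).
Proof.
rewrite sqr_l2norm colspan_projE ?Uhat_orthonormal// dotp_mulmx//.
by rewrite trmxK Uhat_orthonormal.
Qed.

Lemma dotp_proj_le (theta : 'rV[R]_d) :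
  dotp (theta *m U) (theta *m U) <= dotp theta theta.
Proof.
have := dotpp_ge0 (theta - theta *m U *m U^T).
have h : (theta *m U *m U^T) *m (theta *m U *m U^T)^T = theta *m U *m (theta *m U)^T.
  by rewrite trmx_mul trmxK mulmxA -(mulmxA (theta *m U)) Uhat_orthonormal mulmx1.
rewrite dotp_distr !dotpE h !trmx_mul !trmxK !mulmxA.
lra.
Qed.

(** On a sphere centred at the origin the distance to [that i] is a decreasing
    function of the coordinate along [that i], so balls become caps. *)
Lemma l2norm_that_le (theta theta' : 'rV[R]_d) i :
  l2norm theta' = l2norm theta ->
  (l2norm (theta' - that i) <= l2norm (theta - that i)) =
  ((theta *m U) ord0 i <= (theta' *m U) ord0 i).
Proof.
move=> tt; rewrite !l2normE ler_sqrt ?dotpp_ge0// !dotp_distr !dotp_that.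
rewrite -!sqr_l2norm tt lerD2r lerD2l lerN2 ler_pM2l//.
by rewrite ler_pM2l// l2norm_that_gt0.
Qed.

(** When [theta] lies on the boundary of every ball, all points of the intersection with
    the sphere have coordinates at least those of [theta]; these being
    nonnegative, the same holds for the squares, and [theta] attains the infimum. *)
Lemma gamma_star_touching (theta : 'rV[R]_d) :
  (forall i, 0 <= (theta *m U) ord0 i) ->
  gamma_star that (l2norm theta) (\row_i l2norm (theta - that i)) =
  sqrte (dotp (theta *m U) (theta *m U))%:E.
Proof.
move=> x0; congr sqrte; apply/eqP; rewrite eq_le; apply/andP; split.
  apply: ereal_inf_lbound; exists theta; last by rewrite sqr_l2norm_proj.
  by split=> // i; rewrite mxE.
apply: le_ereal_inf_tmp => _ [theta' [/= tt tB] <-].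
rewrite sqr_l2norm_proj lee_fin; apply: ler_sum => i _.
have := tB i; rewrite mxE l2norm_that_le// => le.
by rewrite -!expr2 lerXn2r// nnegrE// (le_trans (x0 i)).
Qed.

Lemma gamma_star_real (e : R) (r : 'rV[R]_m) :
  (l2sphere e `&` ball_inter that r) !=set0 ->
  exists G : R, [/\ 0 <= G, G <= e ^+ 2 & gamma_star that e r = sqrte G%:E].
Proof.
move=> [theta thetaP].
set S := [set (l2norm (colspan_proj U t) ^+ 2)%:E
         | t in l2sphere e `&` ball_inter that r].
have inf_ge0 : (0 <= ereal_inf S)%E.
  by apply: le_ereal_inf_tmp => _ [t _ <-]; rewrite lee_fin sqr_ge0.
have inf_le : (ereal_inf S <= (e ^+ 2)%:E)%E.
  apply: (@le_trans _ _ (l2norm (colspan_proj U theta) ^+ 2)%:E).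
    by apply: ereal_inf_lbound; exists theta.
  rewrite lee_fin sqr_l2norm_proj; case: thetaP => /= <- _.
  by rewrite sqr_l2norm dotp_proj_le.
have fin : ereal_inf S \is a fin_num.
  by rewrite fin_real// (lt_le_trans _ inf_ge0)//= (le_lt_trans inf_le)// ltry.
exists (fine (ereal_inf S)); split.
- exact: fine_ge0.
- by rewrite -lee_fin fineK.
- by rewrite fineK.
Qed.

End predictions.
End euclid.

(** * The lower bound *)

Lemma lte_div_ler (R : realType) (c s g u : R) : 0 < c -> 0 <= s -> 0 <= g ->
  (u%:E < c%:E * (s%:E / g%:E))%E -> u * g <= c * s.
Proof.
move=> c0 s0 g0; have [->|gn0] := eqVneq g 0.
  by rewrite mulr0 mulr_ge0// ltW.
rewrite inver (negbTE gn0) -!EFinM lte_fin mulrA ltr_pdivlMr; last by rewrite lt_def gn0.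
exact: ltW.
Qed.

(** The second moment bound turns a rejection power above [1 - beta] on the
    whole support of a prior into an error of the first kind of at least
    [1 - beta - delta], which exceeds [alpha]. *)
Lemma not_powerful (R : realType) (alpha beta delta : R) (d n : nat)
    (H1 : set 'rV[R]_d) (I : finType) (th : I -> 'rV[R]_d) :
  (0 < n)%N -> 0 < delta -> beta + delta < 1 - alpha -> (0 < #|I|)%N ->
  (forall i, H1 (th i)) ->
  \sum_i \sum_j expR (n%:R * dotp (th i) (th j)) <=
    (1 + delta ^+ 2) * #|I|%:R ^+ 2 ->
  ~ nontrivial_power n alpha beta H1.
Proof.
move=> n0 delta0 gap I0 thH hsum [psi [valid power]].
pose A : set (d.-tuple (measurableTypeR R)) := [set x | psi x = false].
have mA : measurable A.
  rewrite -[A]setTI; exact: (measurable_funPT psi measurableT [set false]).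
have AC : [set x | psi x = true] = ~` A.
  by apply/seteqP; split=> x; rewrite /A /=; case: (psi x).
have hA : (gauss n 0%R A <= (beta + delta)%:E)%E.
  apply: (second_moment_bound n0 I0 delta0 mA hsum) => i.
  apply: ltW; apply: le_lt_trans power; apply: ereal_sup_ubound.
  by exists (th i).
move: valid; rewrite /valid_test AC probability_setC//.
rewrite -(fineK (fin_num_measure (gauss n 0%R) A mA)) in hA *.
rewrite -EFinB !lee_fin in hA *; move: (fine _) hA => p hA; lra.
Qed.

Unset Implicit Arguments.

Theorem theorem4 (R : realType) (alpha beta : R) :
  0 < alpha -> alpha < 1 -> 0 < beta -> beta < 1 - alpha ->
  exists c1 c2 : R, [/\ 0 < c1, 0 < c2 &
    forall d n m : nat, (1 <= d)%N -> (1 <= n)%N -> (1 <= m)%N ->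
    (2 * m <= d)%N ->
    forall that : 'I_m -> 'rV[R]_d,
    (forall i, that i != 0) ->
    (forall i j, i != j -> dotp (that i) (that j) = 0) ->
    forall eps : 'rV[R]_m -> R,
    (forall r, nonneg_vec r -> 0 <= eps r) ->
    gamma_invariant that eps ->
    nontrivial_power n alpha beta (curve_alternative that eps) ->
    forall r : 'rV[R]_m, nonneg_vec r ->
    (l2sphere (eps r) `&` ball_inter that r) !=set0 ->
    (c1%:E * critical_radius n that c2 r <= (eps r)%:E)%E].
Proof.
move=> _ _ _ gap.
pose delta := (1 - alpha - beta) / 2.
have delta0 : 0 < delta by rewrite /delta; lra.
(* [c2] is chosen so that the two sparse priors, with [kappa = 2 * c2], have
   exponential moments at most [exp l = sqrt (1 + delta^2)] each. *)
pose l := ln (1 + delta ^+ 2) / 2.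
have l0 : 0 < l.
  by rewrite /l divr_gt0// ln_gt0// ltrDl exprn_gt0.
pose c2 := ln (1 + l) / 4.
have c20 : 0 < c2 by rewrite /c2 divr_gt0// ln_gt0// ltrDl.
exists 1, c2; split=> // d n m d0 n0 m0 md that that0 that_orth eps eps0 inv power r r0 ne.
have [dm0 mdm d4dm] : [/\ (0 < d - m)%N, (m + (d - m) <= d)%N & (d <= 2 ^ 2 * (d - m))%N].
  by clear -m0 md; split; lia.
set e := eps r in ne *; have e0 : 0 <= e by exact: eps0.
have [G [G0 Ge gammaE]] := gamma_star_real that0 that_orth ne.
rewrite mul1e; apply: ereal_inf_lbound; exists e => //; split=> //.
rewrite gammaE sqr_sqrte ?lee_fin// leNgt; apply/negP => small.
have nG : n%:R * G <= c2 * Num.sqrt m%:R.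
  apply: (lte_div_ler c20 (sqrtr_ge0 _) G0); apply: (lt_le_trans small).
  by rewrite lee_wpmul2l ?lee_fin ?(ltW c20)// ge_min lexx.
have ne2 : n%:R * e ^+ 2 <= c2 * Num.sqrt d%:R.
  apply: (lte_div_ler c20 (sqrtr_ge0 _) (sqr_ge0 e)); apply: (lt_le_trans small).
  by rewrite lee_wpmul2l ?lee_fin ?(ltW c20)// ge_min EFin_expe lexx orbT.
pose U := Uhat that.
have UU : U^T *m U = 1%:M := Uhat_orthonormal that0 that_orth.
have [B [BB UB]] : exists B : 'M[R]_(d - m, d), B *m B^T = 1%:M /\ U^T *m B^T = 0.
  by apply: orthonormal_complement => //; rewrite trmxK.
have [I [x [I0 x_ge0 xx xsum]]] : exists (I : finType) (x : I -> 'rV[R]_m),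
    [/\ (0 < #|I|)%N, forall i j, 0 <= x i ord0 j, forall i, dotp (x i) (x i) = G &
      \sum_i \sum_j expR (n%:R * dotp (x i) (x j)) <=
        expR (expR (2 * (2 * c2)) - 1) * #|I|%:R ^+ 2].
  apply: block_prior => //; first by rewrite mulr_ge0// ltW.
  apply: (le_trans nG); rewrite -mulrA ler_peMl ?ler1n//.
  by rewrite mulr_ge0 ?sqrtr_ge0// ltW.
have [J [y [J0 _ yy ysum]]] : exists (J : finType) (y : J -> 'rV[R]_(d - m)),
    [/\ (0 < #|J|)%N, forall i j, 0 <= y i ord0 j,
      forall i, dotp (y i) (y i) = e ^+ 2 - G &
      \sum_i \sum_j expR (n%:R * dotp (y i) (y j)) <=
        expR (expR (2 * (2 * c2)) - 1) * #|J|%:R ^+ 2].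
  apply: block_prior => //; rewrite ?subr_ge0//; first by rewrite mulr_ge0// ltW.
  apply: (@le_trans _ _ (n%:R * e ^+ 2)); first by rewrite ler_wpM2l// lerBlDr lerDl.
  apply: (le_trans ne2); rewrite -mulrA mulrCA ler_wpM2l ?(ltW c20)//.
  rewrite -[2]ger0_norm// -sqrtr_sqr -sqrtrM ?sqr_ge0// ler_wsqrtr//.
  by rewrite -natrX -natrM ler_nat.
(* [x] gives the coordinates along the predictions, [y] those along their
   orthonormal complement. *)
pose th (ij : I * J) : 'rV[R]_d := x ij.1 *m U^T + y ij.2 *m B.
have BU : B *m U = 0 by apply: trmx_inj; rewrite trmx_mul UB trmx0.
have thU ij : th ij *m U = x ij.1.
  by rewrite mulmxDl -!mulmxA UU BU mulmx1 mulmx0 addr0.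
have dot_th ij kl : dotp (th ij) (th kl) =
    dotp (x ij.1) (x kl.1) + dotp (y ij.2) (y kl.2).
  rewrite !dotpE /th linearD /= mulmxDr !mulmxDl !trmx_mul trmxK.
  rewrite !mulmxA -!(mulmxA _ U^T) -!(mulmxA _ B) UU UB BU BB.
  by rewrite !mulmx1 !mulmx0 !mul0mx addr0 add0r mxE.
have th_norm ij : l2norm (th ij) = e.
  by rewrite l2normE dot_th xx yy addrC subrK sqrtr_sqr ger0_norm.
apply: (@not_powerful _ alpha beta delta d n _ _ th) power => //.
- by rewrite /delta; lra.
- by rewrite card_prod muln_gt0 I0.
- move=> ij; exists (\row_i l2norm (th ij - that i)).
  have r'0 : nonneg_vec (\row_i l2norm (th ij - that i)).
    by move=> i; rewrite mxE sqrtr_ge0.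
  split=> //; last by move=> i; rewrite mxE.
  rewrite th_norm (inv e r)// gammaE -(th_norm ij) gamma_star_touching//.
    by rewrite thU xx.
  by move=> i; rewrite thU.
have -> : \sum_(ij : I * J) \sum_(kl : I * J) expR (n%:R * dotp (th ij) (th kl)) =
    (\sum_i \sum_k expR (n%:R * dotp (x i) (x k))) *
    (\sum_j \sum_l expR (n%:R * dotp (y j) (y l))).
  rewrite [RHS]big_distrlr [RHS]pair_big /=; apply: eq_bigr => ij _.
  rewrite [RHS]big_distrlr [RHS]pair_big /=; apply: eq_bigr => kl _.
  by rewrite dot_th mulrDr expRD.
rewrite card_prod natrM (exprMn _ #|I|%:R).
have c2E : expR (2 * (2 * c2)) - 1 = l.
  have -> : 2 * (2 * c2) = ln (1 + l) by rewrite /c2; field.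
  by rewrite lnK ?posrE ?addr_gt0//; ring.
have lE : expR l * expR l = 1 + delta ^+ 2.
  rewrite -expRD -mulr2n -mulr_natl mulrC divfK//.
  by rewrite lnK// posrE addr_gt0// exprn_gt0.
rewrite c2E in xsum ysum.
rewrite -lE mulrACA; apply: ler_pM => //.
  by do 2 (apply: sumr_ge0 => ? _); exact: expR_ge0.
by do 2 (apply: sumr_ge0 => ? _); exact: expR_ge0.
Qed.
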